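(* Let $n=2^\tau$ with $\tau\ge 1$ an integer, and let $\{W^{(l)}\}_{l\in\mathbb N}\subset\mathbb R^{n\times n}$ be the weight matrices of the one-peer hyper-cubes, i.e. $W^{(l)}=[w^{(l)}_{ij}]_{i,j=0}^{n-1}$ with $$w^{(l)}_{ij}=\begin{cases}\frac12&\text{if } (i\wedge j)=2^{\mathrm{mod}(l,\tau)},\\ \frac12&\text{if } i=j,\\0&\text{otherwise,}\end{cases}$$ where $i\wedge j$ denotes the bit-wise XOR of the integers $i$ and $j$. Then these matrices are symmetric, doubly stochastic, and have the finite-time consensus property $$W^{(\tau-1)}W^{(\tau-2)}\cdots W^{(1)}W^{(0)}=\tfrac1n\mathbf 1\mathbf 1^{\mathsf T}.$$
   Context: $\mathbb N=\{0,1,2,\dots\}$; $\mathrm{mod}(a,m)\in\{0,\dots,m-1\}$ is the remainder of $a$ modulo $m$; $\mathbf 1\in\mathbb R^n$ is the all-ones vector; rows and columns of $n\times n$ matrices are indexed by $0,1,\dots,n-1$. *)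

(* Defs.v *)
From mathcomp Require Import all_boot all_order all_algebra.

Set Implicit Arguments.
Unset Strict Implicit.
Unset Printing Implicit Defensive.

Import GRing.Theory Num.Theory.
Local Open Scope ring_scope.

Definition onevec (R : numDomainType) (n : nat) : 'cV[R]_n := const_mx 1.

Definition doubly_stochastic (R : numDomainType) (n : nat) (A : 'M[R]_n) : Prop :=
  [/\ forall i j, 0 <= A i j,
      A *m onevec R n = onevec R n
    & (onevec R n)^T *m A = (onevec R n)^T].

(* [Nat.lxor] is bitwise XOR on nat; the matrix is meant for n = 2 ^ tau. *)
Definition onepeer_hypercube (R : numFieldType) (n tau l : nat) : 'M[R]_n :=
  \matrix_(i < n, j < n)
    if Nat.lxor i j == (2 ^ (l %% tau))%N then 2%:R^-1
    else if i == j then 2%:R^-1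
    else 0.

(* Main.v *)
(** By induction on [k], the entry [(i, j)] of [W^(k-1) ... W^(0)] is [2^-k] if
    [i] and [j] agree above their [k] lowest bits, i.e. if
    [Nat.lxor i j < 2 ^ k], and [0] otherwise: multiplying by
    [W^(k)] on the left averages each row [i] with the row obtained by flipping
    bit [k] of [i].  For [k = tau] all indices below [2 ^ tau] agree. *)
Require Import Defs.
From Stdlib Require Import PeanoNat.
From mathcomp Require Import all_boot all_order all_algebra.

Set Implicit Arguments.
Unset Strict Implicit.
Unset Printing Implicit Defensive.

Import GRing.Theory Num.Theory.
Local Open Scope ring_scope.

(** Turns bounds by powers of two into equations on shifts, which commute with XOR. *)
Lemma shiftr_eq0 (a k : nat) : (Nat.shiftr a k == 0)%N = (a < 2 ^ k)%N.
Proof.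
elim: k a => [|k IHk] a; first by rewrite expn0 ltnS leqn0.
rewrite -[k.+1]/(Nat.add 1 k) -Nat.shiftr_shiftr IHk.
rewrite -[Nat.shiftr a 1]/(Nat.div2 a) expnS.
have -> : Nat.div2 a = a./2.
  by elim/ltn_ind: a => -[|[|a]] //= IHa; rewrite (IHa a).
by rewrite mul2n ltn_half_double.
Qed.

Lemma shiftr_exp2 (k : nat) : Nat.shiftr (2 ^ k) k = 1%N.
Proof.
have -> : (2 ^ k)%N = Nat.shiftl 1 k.
  by elim: k => // k IHk; rewrite expnS IHk /= /Nat.double mul2n -addnn.
by rewrite Nat.shiftr_shiftl_l // Nat.sub_diag.
Qed.

(** XOR with [a] is an involution. *)
Lemma lxor_eq (a b c : nat) : (Nat.lxor a b == c) = (b == Nat.lxor a c).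
Proof.
by apply/eqP/eqP => [<-|->];
   rewrite -Nat.lxor_assoc Nat.lxor_nilpotent Nat.lxor_0_l.
Qed.

Lemma lxor_ltn_exp2 (a b k : nat) :
  (a < 2 ^ k)%N -> (b < 2 ^ k)%N -> (Nat.lxor a b < 2 ^ k)%N.
Proof.
by rewrite -!shiftr_eq0 Nat.shiftr_lxor => /eqP -> /eqP ->.
Qed.

Lemma lxor_exp2_ltn (x k : nat) :
  (Nat.lxor x (2 ^ k) < 2 ^ k)%N = (2 ^ k <= x < 2 ^ k.+1)%N.
Proof.
rewrite [(2 ^ k <= x)%N]leqNgt -!shiftr_eq0.
rewrite -[k.+1]addn1 -[(k + 1)%N]/(Nat.add k 1) -Nat.shiftr_shiftr.
rewrite Nat.shiftr_lxor shiftr_exp2 lxor_eq Nat.lxor_0_r eq_sym.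
(* With [y] the shift of [x] by [k], both sides say [y = 1]: on the right, [y] is nonzero and its
   half is zero. *)
by case: (Nat.shiftr x k) => [|[|y]].
Qed.

Section HyperCube.

Variables (R : realFieldType) (tau : nat).
Hypothesis tau_gt0 : (0 < tau)%N.

Local Notation n := (2 ^ tau)%N.
Local Notation W := (onepeer_hypercube R n tau).

Lemma bit_ltn (l : nat) : (2 ^ (l %% tau) < n)%N.
Proof. by rewrite ltn_exp2l // ltn_pmod. Qed.

(** The neighbour of [i] along axis [l %% tau] of the hypercube. *)
Definition flip (l : nat) (i : 'I_n) : 'I_n :=
  Ordinal (lxor_ltn_exp2 (ltn_ord i) (bit_ltn l)).

Lemma flip_neq (l : nat) (i : 'I_n) : flip l i != i.
Proof.
by rewrite -val_eqE /= lxor_eq Nat.lxor_nilpotent expn_eq0.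
Qed.

Lemma onepeer_hypercubeE (l : nat) (i j : 'I_n) :
  W l i j = if (j == flip l i) || (j == i) then 2^-1 else 0.
Proof.
rewrite mxE lxor_eq -[j == flip l i]val_eqE /= [j == i]eq_sym.
by case: ifP; case: eqP.
Qed.

(** Row [i] is supported on the two distinct indices [i] and [flip l i]. *)
Lemma sum_onepeer_hypercube (l : nat) (i : 'I_n) (F : 'I_n -> R) :
  \sum_j W l i j * F j = 2^-1 * (F i + F (flip l i)).
Proof.
rewrite (bigD1 i) //= (bigD1 (flip l i)) ?flip_neq //= big1 => [|j /andP[ji jf]].
  by rewrite !onepeer_hypercubeE !eqxx orbT addr0 mulrDr.
by rewrite onepeer_hypercubeE (negPf ji) (negPf jf) mul0r.
Qed.

Lemma onepeer_hypercube_sym (l : nat) : (W l)^T = W l.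
Proof. by apply/matrixP => i j; rewrite !mxE Nat.lxor_comm [j == i]eq_sym. Qed.

Lemma onepeer_hypercube_stochastic (l : nat) : doubly_stochastic (W l).
Proof.
have W1 : W l *m onevec R n = onevec R n.
  apply/matrixP => i k; rewrite mxE sum_onepeer_hypercube !mxE.
  by rewrite -mulr2n mulVf ?pnatr_eq0.
split=> // [i j|].
  by rewrite onepeer_hypercubeE; case: ifP => // _; rewrite invr_ge0 ler0n.
(* By symmetry, column sums are row sums. *)
by rewrite -{1}(onepeer_hypercube_sym l) -trmx_mul W1.
Qed.

Lemma prod_onepeer_hypercubeE (k : nat) (i j : 'I_n) : (k <= tau)%N ->
  (\big[mulmx/1%:M]_(l <- rev (iota 0 k)) W l) i j =
    if (Nat.lxor i j < 2 ^ k)%N then 2 ^- k else 0.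
Proof.
elim: k i => [|k IHk] i k_le.
  rewrite big_nil mxE expn0 ltnS leqn0 lxor_eq Nat.lxor_0_r.
  by rewrite -val_eqE eq_sym invr1; case: eqP.
(* Reversal puts the new index [k] first, so [W k] is the leftmost factor. *)
rewrite -[k.+1]addn1 iotaD add0n rev_cat big_cons mxE sum_onepeer_hypercube.
have flip_xor : Nat.lxor (flip k i) j = Nat.lxor (Nat.lxor i j) (2 ^ k).
  (* Since [k < tau], the remainder is [k] itself. *)
  by rewrite /= modn_small // !Nat.lxor_assoc (Nat.lxor_comm j).
rewrite !(IHk _ (ltnW k_le)) flip_xor lxor_exp2_ltn addn1.
have half : 2^-1 * 2 ^- k = 2 ^- k.+1 :> R by rewrite exprS invfM.
(* The ranges below [2 ^ k] and from [2 ^ k] to [2 ^ k.+1] are disjoint, so at most one of the two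
   averaged entries is nonzero. *)
case: ltnP => [lt_k|_] /=; last first.
  by rewrite add0r; case: ifP; rewrite ?mulr0.
by rewrite addr0 half (leq_trans lt_k) ?leq_exp2l.
Qed.

End HyperCube.

Theorem proposition3p4 (R : realFieldType) (n tau : nat)
    (tau_ge1 : (1 <= tau)%N) (n_eq : n = (2 ^ tau)%N) :
  [/\ forall l : nat, onepeer_hypercube R n tau l \is symmetricmx,
      forall l : nat, doubly_stochastic (onepeer_hypercube R n tau l)
    & \big[mulmx/1%:M]_(l <- rev (iota 0 tau)) onepeer_hypercube R n tau l
      = n%:R^-1 *: (onevec R n *m (onevec R n)^T)].
Proof.
subst n; split=> [l|l|].
(* [symmetricmx] is the Hermitian predicate with sign [(-1) ^+ 0] and the identity as
   conjugation. *)
- apply/is_hermitianmxP; rewrite expr0 scale1r.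
  by rewrite map_mx_id ?onepeer_hypercube_sym.
- exact: onepeer_hypercube_stochastic.
- apply/matrixP => i j.
  rewrite prod_onepeer_hypercubeE // lxor_ltn_exp2 //.
  by rewrite !mxE big_ord1 !mxE !mulr1 natrX.
Qed.
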